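(* Let $G=(V,E)$ be a finite directed graph with $n=|V|$, activation probabilities $p:E\to[0,1]$, negative seed set $S\subseteq V$ and integer time constraint $\tau\ge 0$. For every node $u\in V\setminus S$, the output $\hat H(u)$ returned by Forward Influence Sampling (FIS) with $\phi\ge1$ simulations is an unbiased estimator of $H(u)$, i.e. $\mathbb{E}[\hat H(u)]=H(u)$. Moreover, for any $0<\delta_1<1$ and $0<\psi<1$, and any $u\in V\setminus S$ with $H(u)>0$, if the number of simulations $\phi$ satisfies $$\phi\ \ge\ \frac{3}{\psi^2 H(u)}\ln\left(\frac{2}{n\delta_1}\right),$$ then $$\Pr\left\{\left|\hat H(u)-H(u)\right|\le\psi\cdot H(u)\right\}\ \ge\ 1-n\delta_1 .$$
   Context: TC-IC diffusion of $S$: at time $0$ the nodes of $S$ are activated; at each time $t=1,\dots,\tau$, every node $x$ activated at time $t-1$ makes one attempt to activate each still inactive out-neighbour $y$, succeeding independently with probability $p(x,y)$; the process stops after time $\tau$ (or earlier if no new node is activated). $H(u)$ is the probability that $u$ is activated by time $\tau$ in this diffusion (only $S$ propagating). Forward Influence Sampling (FIS) runs $\phi$ independent simulations of this diffusion and returns, for each $u\in V\setminus S$, $$\hat H(u)=\frac1\phi\sum_{i=1}^{\phi}\mathbf 1\{u\text{ is activated in the }i\text{-th simulation}\}.$$ *)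

(* Defs.v *)
From mathcomp Require Import all_boot all_order all_algebra.
From mathcomp Require Import all_classical all_reals all_analysis.

Set Implicit Arguments.
Unset Strict Implicit.
Unset Printing Implicit Defensive.

Import Order.TTheory GRing.Theory Num.Theory.
Local Open Scope ring_scope.
Local Open Scope classical_set_scope.

(* The edge set as a (finite) type, so that activation probabilities are
   functions on the edges only. *)
Definition edge (V : finType) (E : {set V * V}) := {e : V * V | e \in E}.

(* An attempt is indexed by the step and the edge (x, y) along which x tries to
   activate y; the ordinal t : 'I_tau stands for time t + 1. A node is newly
   activated at most once, so at most one of the attempts (t, e) with e fixed is
   ever looked at; the outcomes of the others are ignored by [step]. *)
Definition attempt (V : finType) (E : {set V * V}) (tau : nat) : Type :=
  ('I_tau * edge E)%type.

(* The first component of a state is the set of active nodes, the second one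
   the set of nodes activated at the previous time. *)
Definition step (V : finType) (E : {set V * V}) (succ : edge E -> bool)
    (s : {set V} * {set V}) : {set V} * {set V} :=
  let new := [set y : V | (y \notin s.1) &&
    [exists e : edge E,
      [&& (val e).1 \in s.2, (val e).2 == y & succ e]]]%SET in
  ((s.1 :|: new)%SET, new).

Definition diffusion (V : finType) (E : {set V * V}) (S : {set V}) (tau : nat)
    (w : attempt E tau -> bool) : {set V} :=
  (foldl (fun s t => step (fun e => w (t, e)) s) (S, S) (enum 'I_tau)).1.

(* Law of the outcomes of the attempts of one diffusion: independent
   Bernoulli variables, with parameter p e along the edge e. *)
Definition attempts_pmf (R : realType) (V : finType) (E : {set V * V})
    (p : edge E -> R) (tau : nat) (w : {ffun attempt E tau -> bool}) : R :=
  \prod_(a : attempt E tau) bernoulli_pmf (p a.2) (w a).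

Definition H (R : realType) (V : finType) (E : {set V * V}) (p : edge E -> R)
    (S : {set V}) (tau : nat) (u : V) : R :=
  \sum_(w : {ffun attempt E tau -> bool} | u \in diffusion S w)
    attempts_pmf p w.

Definition mutually_independent d d' (T : measurableType d)
    (T' : measurableType d') (R : realType) (P : probability T R) (I : finType)
    (X : I -> {RV P >-> T'}) : Prop :=
  forall (J : {set I}) (B : I -> set T'), (forall i, measurable (B i)) ->
    P (\bigcap_(i in [set` J]) (X i @^-1` B i)) =
    (\prod_(i in J) P (X i @^-1` B i))%E.

(* [X (i, a)] is the outcome of the attempt a in the i-th simulation. Mutual
   independence over all the pairs (i, a) expresses both the independence of
   the attempts within a simulation and that of the simulations. *)
Definition independent_simulations d (T : measurableType d) (R : realType)
    (P : probability T R) (V : finType) (E : {set V * V}) (p : edge E -> R)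
    (tau phi : nat) (X : 'I_phi * attempt E tau -> {RV P >-> bool}) : Prop :=
  mutually_independent X /\
  forall i a, P (X (i, a) @^-1` [set true]) = (p a.2)%:E.

Definition FIS d (T : measurableType d) (R : realType)
    (P : probability T R) (V : finType) (E : {set V * V}) (S : {set V})
    (tau phi : nat) (X : 'I_phi * attempt E tau -> {RV P >-> bool}) (u : V) :
    T -> R :=
  fun z => phi%:R^-1 *
    \sum_(i < phi) (u \in diffusion S (fun a => X (i, a) z))%:R.

(* Main.v *)
(* The vector of the phi simulations takes finitely many values, and mutual
   independence of the attempts makes its law the phi-fold product of the law of
   one diffusion. Expectations and probabilities thus become finite sums against
   a product weight, for which the indicators of "u is activated" are i.i.d.
   Bernoulli of parameter H(u): unbiasedness is linearity of the sum, and the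
   deviation bound is the two-sided multiplicative Chernoff bound
   2 exp(- psi^2 phi H(u) / 3), at most n delta1 by the choice of phi. *)
Require Import Defs.
From mathcomp Require Import all_boot all_order all_algebra.
From mathcomp Require Import all_classical all_reals all_analysis.
From mathcomp Require Import measurable_realfun ring lra.

Set Implicit Arguments.
Unset Strict Implicit.
Unset Printing Implicit Defensive.

Import Order.TTheory GRing.Theory Num.Theory.
Import numFieldNormedType.Exports.
Local Open Scope ring_scope.
Local Open Scope classical_set_scope.

(** * A quadratic upper bound on the exponential *)

(** Applied below at 2x/3 with [|x| <= 1], whence the range up to 2/3. The coefficient 3/4 puts the
    second critical point of the [h] of the proof exactly at 2/3. *)
Lemma expR_le_quadratic (R : realType) (x : R) :
  x <= 2 / 3 -> expR x <= 1 + x + 3 / 4 * x ^+ 2.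
Proof.
move=> x_le.
(* On ]-oo, 2/3], h decreases up to 0 and increases afterwards. *)
pose h (y : R) := (1 + y + 3 / 4 * y ^+ 2) * expR (- y).
pose dh (y : R) := y / 2 * (1 - 3 / 2 * y) * expR (- y).
have h_dh (y : R) : is_derive y 1 h (dh y).
  rewrite (_ : h = ((cst 1 : R -> R) + id + (3 / 4) *: (id * id : R -> R)) *
      (@expR R \o -%R : R -> R)).
    apply: is_derive_eq; rewrite !fctE /dh /GRing.scale/=; lra.
  by apply/funext => z; rewrite /h expr2.
have h_cont (a b : R) : {within `[a, b], continuous h}.
  apply: continuous_subspaceT => y.
  by apply/differentiable_continuous/derivable1_diffP; have [] := h_dh y.
have h0 : h 0 = 1 by rewrite /h oppr0 expR0; ring.
suff h_ge1 : 1 <= h x.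
  by rewrite -(ler_pM2r (expR_gt0 (- x))) expRxMexpNx_1.
rewrite -h0 -subr_ge0; have [x_ge0|/ltW x_le0] := leP 0 x.
- have [c] := MVT_segment x_ge0 (fun y _ => h_dh y) (h_cont _ _).
  rewrite in_itv/= => /andP[c_ge0 cx] ->; rewrite subr0.
  rewrite !mulr_ge0 ?expR_ge0//; lra.
- have [c] := MVT_segment x_le0 (fun y _ => h_dh y) (h_cont _ _).
  rewrite in_itv/= => /andP[xc c_le0]; rewrite sub0r => e; rewrite -opprB e.
  rewrite mulrN opprK mulr_le0//; rewrite /dh !mulr_le0_ge0 ?expR_ge0//; lra.
Qed.

(** * Product weights on finite vectors and their Chernoff bound *)

Section product_pmf.
Variables (R : realType) (W : finType) (q : W -> R) (n : nat).
Hypothesis q_ge0 : forall w, 0 <= q w.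
Hypothesis sum_q : \sum_w q w = 1.
Implicit Types (f : {ffun 'I_n -> W}).

Definition product_pmf (f : {ffun 'I_n -> W}) : R := \prod_i q (f i).

Lemma product_pmf_ge0 f : 0 <= product_pmf f.
Proof. by apply: prodr_ge0 => i _. Qed.

Lemma sum_product_pmf : \sum_(f : {ffun 'I_n -> W}) product_pmf f = 1.
Proof.
by rewrite -(bigA_distr_bigA (fun=> q)) big1.
Qed.

(** By distributivity the sum factors over the coordinates, and each coordinate other than [i]
    contributes the total mass 1. *)
Lemma product_pmf_marginal (g : W -> R) (i : 'I_n) :
  \sum_(f : {ffun 'I_n -> W}) g (f i) * product_pmf f = \sum_w g w * q w.
Proof.
pose F j w := (if j == i then g w else 1) * q w.
transitivity (\sum_(f : {ffun 'I_n -> W}) \prod_j F j (f j)).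
  apply: eq_bigr => f _; rewrite big_split /= -big_mkcond/=.
  by rewrite big_pred1_eq.
rewrite -bigA_distr_bigA (bigD1 i)//= [X in _ * X]big1 ?mulr1.
  by rewrite /F eqxx.
move=> j /negPf ji; rewrite -[RHS]sum_q; apply: eq_bigr => w _.
by rewrite /F ji mul1r.
Qed.

Variable A : pred W.
Let h := \sum_(w | A w) q w.
Let N (f : {ffun 'I_n -> W}) : R := \sum_i (A (f i))%:R.

Lemma product_pmf_mgf (s : R) :
  \sum_(f : {ffun 'I_n -> W}) expR (s * N f) * product_pmf f =
  (1 + h * (expR s - 1)) ^+ n.
Proof.
transitivity (\sum_(f : {ffun 'I_n -> W})
    \prod_(i < n) (expR (s * (A (f i))%:R) * q (f i))).
  apply: eq_bigr => f _; rewrite big_split/= -expR_sum.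
  by rewrite mulr_sumr.
rewrite -(bigA_distr_bigA (fun _ w => expR (s * (A w)%:R) * q w)).
rewrite prodr_const card_ord; congr (_ ^+ _).
(* Since [A w] counts as 0 or 1, [expR (s * A w)] is affine in it: [1 + A w * (expR s - 1)]. *)
transitivity (\sum_w (q w + (A w)%:R * q w * (expR s - 1))).
  apply: eq_bigr => w _; case: (A w); rewrite /= ?mulr1 ?mulr0 ?expR0; ring.
rewrite big_split /= sum_q -mulr_suml /h [in RHS]big_mkcond/=.
by congr (1 + _ * _); apply: eq_bigr => w _; case: (A w); rewrite ?mul1r ?mul0r.
Qed.

(* The optimal exponent ln (1 + x) is replaced by 2x/3, for which the quadratic
   bound on the exponential already gives the constant 3. *)
Lemma product_pmf_tail (x : R) : `|x| <= 1 ->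
  \sum_(f : {ffun 'I_n -> W} | 0 <= x * (N f - (1 + x) * (n%:R * h)))
    product_pmf f <=
  expR (- (x ^+ 2 * (n%:R * h) / 3)).
Proof.
rewrite ler_norml => /andP[x_ge x_le].
have h_ge0 : 0 <= h by apply: sumr_ge0.
pose s := 2 / 3 * x; pose c := (1 + x) * (n%:R * h).
(* Exponential Markov inequality: [s] has the sign of [x], so [expR (s * (N f - c))] is at least 1
   on either tail. *)
apply: (@le_trans _ _ (expR (- (s * c)) *
    \sum_(f : {ffun 'I_n -> W}) expR (s * N f) * product_pmf f)).
  rewrite [leRHS]mulr_sumr [leLHS]big_mkcond/=; apply: ler_sum => f _.
  rewrite [leRHS]mulrA -expRD; case: ifPn => [xN|_]; last first.
    by rewrite mulr_ge0 ?expR_ge0 ?product_pmf_ge0.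
  rewrite ler_peMl ?product_pmf_ge0// -expR0 ler_expR /s /c.
  lra.
rewrite product_pmf_mgf.
apply: (@le_trans _ _ (expR (- (s * c)) * expR (h * (expR s - 1)) ^+ n)).
  rewrite ler_wpM2l ?expR_ge0// lerXn2r ?expR_ge1Dx ?nnegrE ?expR_ge0//.
  (* This makes the base [1 - h + h * expR s] nonnegative, so that raising to the power [n]
     preserves the bound [1 + y <= expR y]. *)
  have h_le1 : h <= 1.
    by rewrite -sum_q [leRHS](bigID A)/= lerDl sumr_ge0.
  have := mulr_ge0 h_ge0 (expR_ge0 s); lra.
rewrite -expRM_natl -expRD ler_expR.
(* With s = 2x/3 the terms linear in x cancel, and the coefficient of x^2 is -2/3 + 1/3 = -1/3. *)
have e_le : expR s <= 1 + s + 3 / 4 * s ^+ 2.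
  by apply: expR_le_quadratic; rewrite /s; lra.
have := ler_wpM2l (mulr_ge0 (ler0n R n) h_ge0) e_le.
rewrite /c /s; lra.
Qed.

End product_pmf.

(** * Expectations and probabilities through a map with finitely many values *)

Section finite_law.
Context d (T : measurableType d) (R : realType) (P : probability T R).
Variables (F : finType) (Y : T -> F) (q : F -> R).
Hypothesis mY : forall f, measurable (Y @^-1` [set f]).
Hypothesis PY : forall f, P (Y @^-1` [set f]) = (q f)%:E.

Lemma expectation_finite_law (g : F -> R) : (forall f, 0 <= g f) ->
  ('E_P[g \o Y] = (\sum_f g f * q f)%:E)%E.
Proof.
move=> g_ge0; rewrite unlock.
(* [g \o Y] is a finite combination of indicators of the fibres of [Y]; as [g] is nonnegative, the
   integral is additive without integrability conditions. *)
transitivity (\int[P]_z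
    \sum_(f : F) (g f)%:E * (\1_(Y @^-1` [set f]) z)%:E)%E.
  apply: eq_integral => z _; rewrite (bigD1 (Y z))//= big1 ?adde0.
    by rewrite indicE mem_set//= mule1.
  move=> f /eqP fY; rewrite indicE memNset ?mule0//=.
  by move=> Yf; apply: fY; rewrite Yf.
have m1 f : measurable_fun [set: T] (EFin \o (\1_(Y @^-1` [set f]) : T -> R)).
  exact/measurable_EFinP/measurable_indic.
rewrite ge0_integral_sum//=.
- rewrite -sumEFin; apply: eq_bigr => f _.
  rewrite ge0_integralZl ?lee_fin//; last exact: m1.
  rewrite integral_indic// setIT EFinM; congr (_ * _)%E; exact: PY.
- by move=> f; apply: measurable_funeM; exact: m1.
- by move=> f z _; rewrite mule_ge0// lee_fin.
Qed.

Lemma measurable_finite_law (A : pred F) : measurable [set z | A (Y z)].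
Proof.
rewrite (_ : [set _ | _] = \bigcup_(f in [set f | A f]) Y @^-1` [set f]).
  by apply: fin_bigcup_measurable.
by apply/seteqP; split => [z Az|z [f Af /= Yz]]; [exists (Y z)|rewrite /= Yz].
Qed.

Lemma probability_finite_law (A : pred F) :
  P [set z | A (Y z)] = (\sum_(f | A f) q f)%:E.
Proof.
rewrite -expectation_indic; last exact: measurable_finite_law.
rewrite (_ : \1_ _ = (fun f => (A f)%:R) \o Y).
  rewrite expectation_finite_law// [in RHS]big_mkcond/=; congr (_%:E).
  by apply: eq_bigr => f _; case: (A f); rewrite ?mul1r ?mul0r.
apply/funext => z; rewrite indicE/=.
by have [Az|/negP nAz] := boolP (A (Y z)); [rewrite mem_set|rewrite memNset].
Qed.

End finite_law.

(** * The joint law of the simulations *)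

Lemma sum_attempts_pmf (R : realType) (V : finType) (E : {set V * V})
    (p : edge E -> R) (tau : nat) :
  \sum_(w : {ffun attempt E tau -> bool}) attempts_pmf p w = 1.
Proof.
rewrite /attempts_pmf.
rewrite -(bigA_distr_bigA (fun (a : attempt E tau) b => bernoulli_pmf (p a.2) b)).
by rewrite big1// => a _; rewrite big_bool/= addrC subrK.
Qed.

Section simulations.
Context d (T : measurableType d) (R : realType) (P : probability T R).
Variables (V : finType) (E : {set V * V}) (p : edge E -> R) (tau phi : nat).
Variable X : 'I_phi * attempt E tau -> {RV P >-> bool}.
Hypothesis hX : independent_simulations p X.

(** Finite functions are used so that the values form a [finType], as the finite-law lemmas
    require. *)
Definition simulations (z : T) : {ffun 'I_phi -> {ffun attempt E tau -> bool}} :=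
  [ffun i => [ffun a => X (i, a) z]].

(** Gives a fibre the shape to which mutual independence applies, with the full index set. *)
Lemma simulations_preimage f : simulations @^-1` [set f] =
  \bigcap_(ia in [set` [set: 'I_phi * attempt E tau]%SET])
     (X ia @^-1` [set f ia.1 ia.2]).
Proof.
apply/seteqP; split => [z <- [i a] _|z Xz]/=; first by rewrite !ffunE.
apply/ffunP => i; apply/ffunP => a; rewrite !ffunE.
by apply: (Xz (i, a)); rewrite /= inE.
Qed.

Lemma measurable_simulations f : measurable (simulations @^-1` [set f]).
Proof.
rewrite simulations_preimage; apply: fin_bigcap_measurable => // ia _.
by apply: measurable_funPTI.
Qed.

Lemma simulations_law f :
  P (simulations @^-1` [set f]) =
  (product_pmf (attempts_pmf p (tau := tau)) f)%:E.
Proof.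
have [indepX PX] := hX.
rewrite simulations_preimage (indepX _ (fun ia => [set f ia.1 ia.2]))//.
rewrite /product_pmf /attempts_pmf pair_bigA -prodEFin.
rewrite (eq_bigl xpredT) => [|ia]; last by rewrite inE.
apply: eq_bigr => -[i a] _ /=; case: (f i a) => //=.
(* Only the probability of success is given; that of failure comes from the complement. *)
rewrite (_ : _ @^-1` _ = ~` (X (i, a) @^-1` [set true])).
  by rewrite probability_setC ?PX// -[X in measurable X]setTI; apply: measurable_funPT.
by apply/seteqP; split => z /=; case: (X _ z).
Qed.

Lemma FIS_simulations (S : {set V}) (u : V) (z : T) :
  FIS S X u z = phi%:R^-1 *
    \sum_(i < phi) (u \in diffusion S (simulations z i))%:R.
Proof.
congr (_ * _); apply: eq_bigr => i _; congr (u \in diffusion S _)%:R.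
by apply/funext => a; rewrite !ffunE.
Qed.

End simulations.

(** * Mean and deviation of the estimator *)

Theorem theorem2 (R : realType) (V : finType) (E : {set V * V})
    (p : edge E -> R) (hp : forall e : edge E, 0 <= p e <= 1)
    (S : {set V}) (tau : nat)
    (phi : nat) (hphi : (1 <= phi)%N)
    (d : measure_display) (T : measurableType d) (P : probability T R)
    (X : 'I_phi * attempt E tau -> {RV P >-> bool})
    (hX : independent_simulations p X)
    (u : V) (hu : u \notin S) :
  ('E_P[FIS S X u] = (H p S tau u)%:E)%E /\
  (forall delta1 psi : R,
     0 < delta1 < 1 -> 0 < psi < 1 -> 0 < H p S tau u ->
     3 / (psi ^+ 2 * H p S tau u) * ln (2 / (#|V|%:R * delta1)) <= phi%:R ->
     ((1 - #|V|%:R * delta1)%R%:E <=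
      P [set z | (`|FIS S X u z - H p S tau u| <= psi * H p S tau u)%R])%E).
Proof.
set q := attempts_pmf p (tau := tau).
pose A (w : {ffun attempt E tau -> bool}) := u \in diffusion S w.
pose N (f : {ffun 'I_phi -> {ffun attempt E tau -> bool}}) : R :=
  \sum_i (A (f i))%:R.
have phi_gt0 : 0 < phi%:R :> R by rewrite ltr0n.
have q_ge0 w : 0 <= q w by apply: prodr_ge0 => a _; exact: bernoulli_pmf_ge0.
have sum_q : \sum_w q w = 1 by exact: sum_attempts_pmf.
have mY f : measurable (simulations X @^-1` [set f]).
  exact: measurable_simulations.
have PY f : P (simulations X @^-1` [set f]) = (product_pmf q f)%:E.
  exact: simulations_law.
have FISE z : FIS S X u z = phi%:R^-1 * N (simulations X z).
  exact: FIS_simulations.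
split.
  rewrite (_ : FIS S X u = (fun f => phi%:R^-1 * N f) \o simulations X); last first.
    exact/funext.
  rewrite (expectation_finite_law mY PY) => [|f]; last first.
    by rewrite mulr_ge0 ?invr_ge0 ?ler0n// sumr_ge0.
  congr (_%:E); under eq_bigr do rewrite -mulrA mulr_suml.
  rewrite -mulr_sumr exchange_big/=.
  under eq_bigr => i _ do
    rewrite (product_pmf_marginal sum_q (fun w => (A w)%:R)).
  rewrite sumr_const card_ord -[X in _ * X]mulr_natl mulKf ?gt_eqF//.
  rewrite /H [RHS]big_mkcond/=; apply: eq_bigr => w _.
  by rewrite -/(A w); case: (A w); rewrite ?mul1r ?mul0r.
move=> delta psi /andP[delta_gt0 delta_lt1] /andP[psi_gt0 psi_lt1] H_gt0 phi_ge.
set h := H p S tau u in H_gt0 phi_ge *.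
have V_gt0 : 0 < #|V|%:R :> R by rewrite ltr0n; apply/card_gt0P; exists u.
set c := #|V|%:R * delta in phi_ge *.
have c_gt0 : 0 < c by rewrite mulr_gt0.
have tail_le : expR (- (psi ^+ 2 * (phi%:R * h) / 3)) <= c / 2.
  (* In this form the claim compares exponents, and becomes the hypothesis on [phi] with its
     denominators cleared. *)
  have -> : c / 2 = expR (- ln (2 / c)).
    by rewrite expRN lnK ?posrE ?divr_gt0// invf_div.
  have k_gt0 : 0 < psi ^+ 2 * h by rewrite mulr_gt0 ?exprn_gt0.
  rewrite ler_expR lerN2 ler_pdivlMr// mulrC.
  by move: phi_ge; rewrite mulrAC ler_pdivrMr//; lra.
(* The factor [x] covers both tails: [x = psi] gives [N f >= (1 + psi) * phi * h], and [x = - psi]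
   gives [N f <= (1 - psi) * phi * h]. *)
pose tail x f := 0 <= x * (N f - (1 + x) * (phi%:R * h)).
have tailP (x : R) : `|x| = psi -> \sum_(f | tail x f) product_pmf q f <= c / 2.
  move=> x_psi; apply: le_trans tail_le.
  rewrite -x_psi real_normK ?num_real//.
  by apply: (product_pmf_tail phi q_ge0 sum_q); rewrite x_psi ltW.
pose good f := `|phi%:R^-1 * N f - h| <= psi * h.
rewrite (_ : [set z | _] = [set z | good (simulations X z)]); last first.
  by apply/seteqP; split => z /=; rewrite FISE.
rewrite (probability_finite_law mY PY) lee_fin.
have := sum_product_pmf phi sum_q; rewrite (bigID good)/=.
suff bad_le : \sum_(f | ~~ good f) product_pmf q f <= c by lra.
have tail_psi := tailP psi (gtr0_norm psi_gt0).
have tail_Npsi : \sum_(f | tail (- psi) f) product_pmf q f <= c / 2.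
  by apply: tailP; rewrite normrN gtr0_norm.
(* Union bound: each bad vector lies in one of the two tails, each of weight at most [c / 2]. *)
apply: (@le_trans _ _ (\sum_(f | tail psi f) product_pmf q f +
    \sum_(f | tail (- psi) f) product_pmf q f)); last by lra.
rewrite [leLHS]big_mkcond [X in _ <= X + _]big_mkcond [X in _ <= _ + X]big_mkcond.
rewrite -big_split/=; apply: ler_sum => f _.
have q_f := product_pmf_ge0 q_ge0 f.
case: ifPn => [|_]; last by case: ifP; case: ifP; rewrite ?addr0 ?add0r ?addr_ge0.
rewrite /good ler_norml negb_and -!ltNge => bad.
suff : tail psi f || tail (- psi) f.
  by case: (tail psi f) => /= [_|->]; [case: ifP; rewrite ?addr0 ?lerDl|rewrite add0r].
have N_phi : N f = phi%:R * (phi%:R^-1 * N f) by rewrite mulVKf ?gt_eqF.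
rewrite /tail N_phi; move: (phi%:R^-1 * N f) bad => m /orP[m_lt|m_gt]; apply/orP.
- right; rewrite mulr_le0// ?oppr_le0 ?ltW//.
  rewrite (_ : _ - _ = phi%:R * (m - (1 - psi) * h)); last by ring.
  by rewrite pmulr_rlt0//; lra.
- left; rewrite mulr_ge0 ?(ltW psi_gt0)//.
  rewrite (_ : _ - _ = phi%:R * (m - (1 + psi) * h)); last by ring.
  by rewrite mulr_ge0 ?(ltW phi_gt0)//; lra.
Qed.
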